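(* Let $(\Omega,\mathcal{B})$ be a measurable space, let $\mathcal{P}$ be a set of probability measures on $(\Omega,\mathcal{B})$, let $\mathcal{A}$ be a nonempty weakly closed subset of a (real) reflexive Banach space $\mathcal{X}$, and let $\mathrm{S}:\mathcal{A}\times\Omega\to\mathbb{R}$ be a function such that $\mathrm{S}(a,\cdot)$ is measurable for every $a\in\mathcal{A}$. Suppose that $\mathrm{S}$ is weakly lower semicontinuous in its first component (that is, for every $\omega\in\Omega$ the function $a\mapsto \mathrm{S}(a,\omega)$ is lower semicontinuous on $\mathcal{A}$ with respect to the weak topology inherited from $\mathcal{X}$) and uniformly bounded from below. Let $P\in\mathcal{P}$. If the function $a\mapsto \mathrm{S}(a,P)$ is coercive on $\mathcal{A}$, then it attains its minimum on $\mathcal{A}$.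
   Context: For $a\in\mathcal{A}$ and $P\in\mathcal{P}$, write $\mathrm{S}(a,P)=\int \mathrm{S}(a,\omega)\,\mathrm{d}P(\omega)$, which may take the value $+\infty$. The mapping $\mathrm{S}:\mathcal{A}\times\Omega\to\mathbb{R}$ is called uniformly bounded from below if there exists a function $g:\Omega\to\mathbb{R}$ which is integrable with respect to any $P\in\mathcal{P}$ and such that $\mathrm{S}(a,\cdot)\ge g$ holds for all $a\in\mathcal{A}$. The weak topology on $\mathcal{X}$ is the weakest topology for which all continuous real-valued linear functionals on $\mathcal{X}$ are continuous. A function $h$ on $\mathcal{A}\subset\mathcal{X}$ with values in $\mathbb{R}\cup\{\infty\}$ is coercive if for any sequence $(x_n)_{n\in\mathbb{N}}\subset\mathcal{A}$, $\lim_{n\to\infty}\|x_n\|=\infty$ implies $\lim_{n\to\infty}h(x_n)=\infty$. *)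

(* Defs.v *)
From HB Require Import structures.
From mathcomp Require Import all_boot all_order all_algebra.
From mathcomp Require Import all_classical all_reals all_analysis.
Set Implicit Arguments.
Unset Strict Implicit.
Unset Printing Implicit Defensive.
Import Order.TTheory GRing.Theory Num.Theory.
Import numFieldNormedType.Exports.
Local Open Scope classical_set_scope.
Local Open Scope ring_scope.

Section Dual.
Variables (R : realType) (X : normedModType R).

Definition dual_pred : {pred X -> R^o} :=
  [pred f : X -> R^o | `[< linear f /\ continuous f >]].

Record dual := Dual {
  dual_fun :> X -> R^o ;
  dual_funP : dual_fun \in dual_pred }.

HB.instance Definition _ := [isSub for dual_fun].
HB.instance Definition _ := [Choice of dual by <:].

Lemma dual_predP (f : X -> R^o) :
  reflect (linear f /\ continuous f) (f \in dual_pred).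
Proof. exact: asboolP. Qed.

Lemma dual_submod_closed : submod_closed dual_pred.
Proof.
split.
  apply/dual_predP; split; first by move=> a u v; rewrite scaler0 addr0.
  by move=> x; exact: cvg_cst.
move=> a f g /dual_predP[lf cf] /dual_predP[lg cg]; apply/dual_predP.
split; last by move=> x; apply: cvgD; [apply: cvgZr; exact: cf|exact: cg].
move=> b u v.
rewrite -[LHS]/(a *: f (b *: u + v) + g (b *: u + v)) lf lg.
rewrite -[RHS]/(b *: (a *: f u + g u) + (a *: f v + g v)).
by rewrite !scalerDr !scalerA (mulrC a b) addrACA.
Qed.

HB.instance Definition _ := GRing.isSubmodClosed.Build _ _ dual_pred
  dual_submod_closed.
HB.instance Definition _ := [SubChoice_isSubLmodule of dual by <:].

Lemma dual_linear (f : dual) : linear f.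
Proof. by have /dual_predP[] := dual_funP f. Qed.

Lemma dual_continuous (f : dual) : continuous f.
Proof. by have /dual_predP[] := dual_funP f. Qed.

HB.instance Definition _ (f : dual) :=
  GRing.isLinear.Build R X R^o _ (dual_fun f) (@dual_linear f).

Definition dual_norm (f : dual) : R :=
  sup [set `|f x| | x in [set x : X | `|x| <= 1]].

Lemma dual_norm_has_sup (f : dual) :
  has_sup [set `|f x| | x in [set x : X | `|x| <= 1]].
Proof.
split; first by exists `|f 0|; exists 0 => //=; rewrite normr0.
have /linear_bounded_continuous/bounded_funP/(_ 1)[M hM] := @dual_continuous f.
by exists M => _ [x /= x1 <-]; exact: hM.
Qed.

Lemma dual_norm_ub (f : dual) (x : X) : `|x| <= 1 -> `|f x| <= dual_norm f.
Proof. by move=> x1; apply: sup_upper_bound; [exact: dual_norm_has_sup|exists x]. Qed.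

Lemma dual_norm_le (f : dual) (M : R) :
  (forall x : X, `|x| <= 1 -> `|f x| <= M) -> dual_norm f <= M.
Proof.
move=> hM; apply: ge_sup; first by have [] := dual_norm_has_sup f.
by move=> _ [x /= x1 <-]; exact: hM.
Qed.

Let dual_normD (f g : dual) : dual_norm (f + g) <= dual_norm f + dual_norm g.
Proof.
apply: dual_norm_le => x x1.
by apply: le_trans (ler_normD (f x) (g x)) _; apply: lerD; exact: dual_norm_ub.
Qed.

Let dual_normZ (l : R) (f : dual) : dual_norm (l *: f) = `|l| * dual_norm f.
Proof.
have le_normZ (k : R) (h : dual) : dual_norm (k *: h) <= `|k| * dual_norm h.
  apply: dual_norm_le => x x1; rewrite -[X in `|X|]/(k * h x) normrM.
  by apply: ler_wpM2l => //; exact: dual_norm_ub.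
apply/eqP; rewrite eq_le le_normZ /=.
have [->|l0] := eqVneq l 0.
  rewrite normr0 mul0r; apply: le_trans (normr_ge0 _) (dual_norm_ub _ (x := 0) _).
  by rewrite normr0.
rewrite -ler_pdivlMl ?normr_gt0// -normfV.
by rewrite -[in X in X <= _](scalerK l0 f).
Qed.

Let dual_norm0_eq0 (f : dual) : dual_norm f = 0 -> f = 0.
Proof.
move=> f0; apply: val_inj; apply/funext => x /=.
have [->|x0] := eqVneq x 0; first exact: linear0.
have := @dual_norm_ub f (`|x|^-1 *: x); rewrite f0 normrZ normfV normr_id mulVf ?normr_eq0//.
move=> /(_ (lexx _)); rewrite linearZ /= normr_le0.
by rewrite scaler_eq0 invr_eq0 normr_eq0 (negbTE x0) /= => /eqP.
Qed.

HB.instance Definition _ := Lmodule_isNormed.Build R dual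
  dual_normD dual_normZ dual_norm0_eq0.

(* The coarsest topology making every element of the dual continuous. *)
Definition weak_topology : topologicalType :=
  sup_topology (fun f : dual => Topological.on (initial_topology f)).

End Dual.

(* Surjectivity of the canonical embedding into the bidual; the topology of
   [dual X] is the one of the operator norm. *)
Definition reflexive_space (R : realType) (X : normedModType R) : Prop :=
  forall Phi : dual (dual X), exists x : X, forall f : dual X, Phi f = f x.

Section Weak.
Variables (R : realType) (X : normedModType R).

Definition weakly_closed (A : set X) : Prop := closed (A : set (weak_topology X)).

(* [weak_topology X] has the same carrier as [X]; the detour through [B] makes
   [set_type] carry the trace of the weak topology rather than that of the norm
   topology. *)
Definition weakly_lower_semicontinuous (A : set X) (h : A -> \bar R) : Prop :=
  let B : set (weak_topology X) := A in
  lower_semicontinuous (h : set_type B -> \bar R).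

Definition coercive (A : set X) (h : A -> \bar R) : Prop :=
  forall x : nat -> A,
    (fun n => `|set_val (x n)|) @ \oo --> +oo -> h (x n) @[n --> \oo] --> +oo%E.

End Weak.

Section Score.
Variables (d : measure_display) (Omega : measurableType d) (R : realType).
Variables (A : Type) (S : A -> Omega -> R).

Definition expected_score (P : probability Omega R) (a : A) : \bar R :=
  (\int[P]_w (S a w)%:E)%E.

Definition uniformly_bounded_below (Ps : set (probability Omega R)) : Prop :=
  exists g : Omega -> R,
    (forall P, Ps P -> P.-integrable [set: Omega] (EFin \o g)) /\
    (forall a w, g w <= S a w).

End Score.

Definition attains_minimum (R : realType) (A : Type) (h : A -> \bar R) : Prop :=
  exists a : A, forall b : A, (h a <= h b)%E.

(* Main.v *)
(* A minimizing sequence is bounded by coercivity, and Fatou's lemma, applied to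
   differences with the integrable minorant [g], carries the minimum to a weak
   limit. Fatou's lemma is about sequences, so a weakly convergent subsequence
   is needed: the easy half of the Eberlein-Smulian theorem. It is obtained as
   follows. In a reflexive space, every ultrafilter on the indices of a bounded
   sequence x has a weak limit, because f |-> lim f(x_n) belongs to the bidual;
   by Hahn-Banach this limit lies in the closed span of x. Countably many
   functionals F_m separate the points of that closed span. Choose k_i >= i such
   that F_m(x_(k_i)) is within 1/(i+1) of F_m(y) for all m <= i, where y is one
   ultrafilter limit: then every ultrafilter limit of x_(k_i) is y, so that
   x_(k_i) converges weakly to y. *)
Require Import Defs.
From HB Require Import structures.
From mathcomp Require Import all_boot all_order all_algebra.
From mathcomp Require Import all_classical all_reals all_analysis.
From mathcomp Require Import measurable_realfun lra.
Set Implicit Arguments.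
Unset Strict Implicit.
Unset Printing Implicit Defensive.
Import Order.TTheory GRing.Theory Num.Theory.
Import numFieldNormedType.Exports.
Local Open Scope classical_set_scope.
Local Open Scope ring_scope.

(** * The Hahn-Banach theorem by way of minimal sublinear functionals *)

Section Sublinear.
Context {R : realType} {V : lmodType R}.
Implicit Types (p q : V -> R) (x y : V).

Definition sublinear p :=
  (forall x y, p (x + y) <= p x + p y) /\
  (forall c x, 0 <= c -> p (c *: x) <= c * p x).

Lemma sublinear0 p : sublinear p -> p 0 = 0.
Proof.
move=> [pD pZ]; apply/eqP; rewrite eq_le; apply/andP; split.
  by have := pZ 0 0 (lexx _); rewrite scale0r mul0r.
by have := pD 0 0; rewrite addr0 -{1}(addr0 (p 0)) lerD2l.
Qed.

Lemma sublinearZ p c x : sublinear p -> 0 <= c -> p (c *: x) = c * p x.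
Proof.
move=> sp; rewrite le_eqVlt => /predU1P[<-|c0].
  by rewrite scale0r mul0r sublinear0.
apply/eqP; rewrite eq_le (sp.2 _ _ (ltW c0)) /=.
rewrite -ler_pdivlMl//; apply: le_trans (sp.2 _ _ _); last by rewrite invr_ge0 ltW.
by rewrite scalerA mulVf ?scale1r// gt_eqF.
Qed.

Lemma sublinear_ge_opp p x : sublinear p -> - p (- x) <= p x.
Proof.
by move=> sp; rewrite lerNl -subr_ge0 opprK -(sublinear0 sp) -(addNr x); exact: sp.1.
Qed.

(* The largest sublinear minorant of [p] whose value at [- y] is at most [- p y];
   a minimal sublinear functional equals all its [lower_along], hence is linear. *)
Definition lower_along p y x : R :=
  inf [set p (x + t *: y) - t * p y | t in [set t | 0 <= t]].

(** Subadditivity at [t *: y = (x + t *: y) - x]. The infimum in [lower_along] is therefore that of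
    a set bounded below, not a default value of [inf]. *)
Lemma lower_along_lb p y x : sublinear p ->
  lbound [set p (x + t *: y) - t * p y | t in [set t | 0 <= t]] (- p (- x)).
Proof.
move=> sp _ [t /= t0 <-]; rewrite -sublinearZ// lerBrDr addrC lerBlDr.
apply: le_trans (sp.1 _ _); rewrite addrAC subrr add0r //.
Qed.

Lemma lower_along_le p y x t : sublinear p -> 0 <= t ->
  lower_along p y x <= p (x + t *: y) - t * p y.
Proof.
move=> sp t0; apply: ge_inf; last by exists t.
by exists (- p (- x)); exact: lower_along_lb.
Qed.

Lemma le_lower_along p y x m : sublinear p ->
  (forall t, 0 <= t -> m <= p (x + t *: y) - t * p y) ->
  m <= lower_along p y x.
Proof.
move=> sp pm; apply: lb_le_inf; first by exists (p (x + 0 *: y) - 0 * p y), 0 => /=.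
by move=> _ [t /= t0 <-]; exact: pm.
Qed.

Lemma lower_along_le_self p y x : sublinear p -> lower_along p y x <= p x.
Proof.
move=> sp; have := lower_along_le y x sp (lexx 0).
by rewrite scale0r addr0 mul0r subr0.
Qed.

Lemma lower_along_opp p y : sublinear p -> lower_along p y (- y) <= - p y.
Proof.
move=> sp; have := lower_along_le y (- y) sp ler01.
by rewrite scale1r addNr sublinear0// mul1r sub0r.
Qed.

(** The terms with parameters [t] and [s] combine into the one with parameter [t + s]; scaling [x]
    by [c] turns [t] into [c * t]. *)
Lemma sublinear_lower_along p y : sublinear p -> sublinear (lower_along p y).
Proof.
move=> sp; split=> [x x'|c x].
  rewrite -lerBlDr; apply: le_lower_along => // t t0.
  rewrite lerBlDr -lerBlDl; apply: le_lower_along => // s s0.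
  have ts := lower_along_le y (x + x') sp (addr_ge0 t0 s0).
  have := sp.1 (x + t *: y) (x' + s *: y).
  rewrite addrACA -scalerDl; lra.
rewrite le_eqVlt => /predU1P[<-|c0].
  rewrite scale0r mul0r; apply: le_trans (lower_along_le_self _ _ sp) _.
  by rewrite sublinear0.
rewrite -ler_pdivrMl//; apply: le_lower_along => // t t0.
rewrite ler_pdivrMl//.
apply: le_trans (lower_along_le y _ sp (mulr_ge0 (ltW c0) t0)) _.
by rewrite -scalerA -scalerDr (sublinearZ _ sp (ltW c0)) mulrBr mulrA.
Qed.

(** Zorn's lemma for the reversed pointwise order on the sublinear minorants of [p]: a nonempty
    chain is bounded by its pointwise infimum, the empty one by [p]. *)
Lemma minimal_sublinear p : sublinear p ->
  exists q, [/\ sublinear q, (forall x, q x <= p x) &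
    forall r, sublinear r -> (forall x, r x <= q x) -> r = q].
Proof.
move=> sp; pose below := {q : V -> R | sublinear q /\ forall x, q x <= p x}.
pose ge_rel : rel below := fun r s => `[< forall x, sval s x <= sval r x >].
have [||||q qmin] := @Zorn below ge_rel.
- by move=> q; apply/asboolP.
- move=> q r s /asboolP qr /asboolP rs; apply/asboolP => x.
  exact: le_trans (rs x) (qr x).
- move=> [q hq] [r hr] /asboolP/= qr /asboolP/= rq.
  by apply/eq_exist/funext => x; apply/eqP; rewrite eq_le rq qr.
- move=> A Atot; have [[r0 Ar0]|A0] := pselect (exists r, A r); last first.
    exists (exist _ p (conj sp (fun=> lexx _))) => r Ar.
    by exfalso; apply: A0; exists r.
  pose m x := inf [set sval r x | r in A].
  have m_lb x : lbound [set sval r x | r in A] (- p (- x)).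
    move=> _ [r Ar <-]; apply: le_trans (sublinear_ge_opp _ (svalP r).1).
    by rewrite lerN2 (svalP r).2.
  have m_le r x : A r -> m x <= sval r x.
    by move=> Ar; apply: ge_inf; [exists (- p (- x)); exact: m_lb|exists r].
  have le_m c x : (forall r, A r -> c <= sval r x) -> c <= m x.
    move=> cr; apply: lb_le_inf; first by exists (sval r0 x), r0.
    by move=> _ [r Ar <-]; exact: cr.
  have sm : sublinear m.
    split=> [x y|c x].
      rewrite -lerBlDr; apply: (le_m) => r Ar.
      rewrite lerBlDr -lerBlDl; apply: (le_m) => s As.
      rewrite lerBlDl.
      (* As the chain is totally ordered, the smaller of [r] and [s] can be used at both points. *)
      have [/asboolP rs|/asboolP sr] := Atot _ _ Ar As.
        apply: le_trans (m_le _ _ As) _; apply: le_trans ((svalP s).1.1 _ _) _.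
        by rewrite lerD2r rs.
      apply: le_trans (m_le _ _ Ar) _; apply: le_trans ((svalP r).1.1 _ _) _.
      by rewrite lerD2l sr.
    rewrite le_eqVlt => /predU1P[<-|c0].
      rewrite scale0r mul0r -(sublinear0 (svalP r0).1); exact: (m_le).
    rewrite -ler_pdivrMl//; apply: (le_m) => r Ar; rewrite ler_pdivrMl//.
    apply: le_trans (m_le _ _ Ar) _; apply: (svalP r).1.2; exact: ltW.
  have mp x : m x <= p x by apply: le_trans (m_le _ x Ar0) ((svalP r0).2 x).
  exists (exist _ m (conj sm mp)) => r Ar; apply/asboolP => x /=; exact: (m_le).
exists (sval q); split=> [||r sr rq]; [exact: (svalP q).1|exact: (svalP q).2|].
have rp x : r x <= p x by apply: le_trans (rq x) ((svalP q).2 x).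
by rewrite -(qmin (exist _ r (conj sr rp)))//; apply/asboolP.
Qed.

Lemma minimal_sublinear_linear q : sublinear q ->
  (forall r, sublinear r -> (forall x, r x <= q x) -> r = q) ->
  linear (q : V -> R^o).
Proof.
move=> sq qmin.
have lq y : lower_along q y = q.
  apply: qmin; first exact: sublinear_lower_along.
  by move=> x; exact: lower_along_le_self.
have qD x y : q (x + y) = q x + q y.
  apply/eqP; rewrite eq_le sq.1 /= -lerBrDr.
  by have := lower_along_le y x sq ler01; rewrite lq scale1r mul1r.
have qN x : q (- x) = - q x.
  by apply/eqP; rewrite -subr_eq0 opprK -qD addNr sublinear0.
move=> a u v; rewrite qD; congr (_ + _).
have [a0|/ltW a0] := leP 0 a; first exact: sublinearZ.
rewrite -[a in LHS]opprK scaleNr qN sublinearZ ?oppr_ge0//.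
by rewrite mulNr opprK.
Qed.

Theorem hahn_banach_sublinear p x0 : sublinear p -> exists f : V -> R,
  [/\ linear (f : V -> R^o), (forall x, f x <= p x) & f x0 = p x0].
Proof.
move=> sp; have sl := sublinear_lower_along x0 sp.
(* Minimizing below [lower_along p x0] forces [f (- x0) <= - p x0]. *)
have [f [sf fl /(minimal_sublinear_linear sf) lf]] := minimal_sublinear sl.
have fp x : f x <= p x by apply: le_trans (fl x) (lower_along_le_self _ _ sp).
exists f; split=> //; apply/eqP; rewrite eq_le fp /= -lerN2.
apply: le_trans (lower_along_opp x0 sp).
apply: le_trans (fl _); rewrite -(scaleN1r x0) -[_ *: _]addr0 lf sublinear0//.
by rewrite addr0 -[_ *: f _]/(-1 * f x0) mulN1r.
Qed.

End Sublinear.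

(** * Functionals on normed spaces and separability of spans *)

Section DualSpace.
Context {R : realType} {X : normedModType R}.
Implicit Types (x y : X) (f : dual X).

Lemma bounded_linear_dual (g : X -> R) (C : R) :
  linear (g : X -> R^o) -> (forall x, `|g x| <= C * `|x|) ->
  exists f, forall x, f x = g x.
Proof.
move=> lg gC.
pose L := GRing.isLinear.Build R X R^o _ (g : X -> R^o) lg.
pose gl : {linear X -> R^o} := HB.pack (g : X -> R^o) L.
have cg : continuous gl.
  apply/linear_bounded_continuous/bounded_funP => r; exists (`|C| * r) => x xr.
  apply: le_trans (gC x) _; apply: le_trans (ler_norm _) _.
  by rewrite normrM normr_id ler_wpM2l.
have gd : (g : X -> R^o) \in @dual_pred R X by apply/dual_predP; split.
by exists (Dual gd).
Qed.

Lemma dual_le_norm f x : `|f x| <= `|f| * `|x|.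
Proof.
have [->|x0] := eqVneq x 0; first by rewrite linear0 !normr0 mulr0.
have nx : 0 < `|x| by rewrite normr_gt0.
have := @dual_norm_ub _ _ f (`|x|^-1 *: x).
rewrite normrZ normfV normr_id mulVf ?gt_eqF// => /(_ (lexx _)).
by rewrite linearZ normrZ normfV normr_id ler_pdivrMl// mulrC.
Qed.

Lemma sublinear_dual (p : X -> R) x0 :
  sublinear p -> (forall x, p x <= `|x|) ->
  exists f, [/\ (forall x, f x <= p x), (forall x, `|f x| <= `|x|) & f x0 = p x0].
Proof.
move=> sp pn; have [g [lg gp gx0]] := hahn_banach_sublinear x0 sp.
have gn x : `|g x| <= `|x|.
  rewrite ler_norml (le_trans (gp x) (pn x)) andbT lerNl.
  have -> : - g x = g (- x).
    have := lg (-1) x 0; rewrite addr0 scaleN1r => ->.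
    have := lg (-1) 0 0; rewrite scaler0 addr0 scaleN1r addNr => ->.
    by rewrite addr0 -[_ *: _]/(-1 * g x) mulN1r.
  by rewrite -normrN (le_trans (gp _) (pn _)).
have [|f fg] := @bounded_linear_dual g 1 lg; first by move=> x; rewrite mul1r.
by exists f; split=> [x|x|]; rewrite fg.
Qed.

Lemma norming_functional x : exists f, f x = `|x| /\ forall y, `|f y| <= `|y|.
Proof.
have [|//|f [_ fn fx]] := @sublinear_dual (fun y => `|y|) x.
  split=> [y z|c y c0]; first exact: ler_normD.
  by rewrite normrZ ger0_norm.
by exists f.
Qed.

(** Hahn-Banach gives a functional that vanishes on [W] and whose value at [x] is the distance to
    [W], which must then be zero. *)
Lemma annihilator_approx (W : set X) x : W 0 ->
  (forall (a : R) u v, W u -> W v -> W (a *: u + v)) ->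
  (forall f, (forall v, W v -> f v = 0) -> f x = 0) ->
  forall e, 0 < e -> exists2 v, W v & `|x - v| < e.
Proof.
move=> W0 WL fx e e0.
(* The distance to [W] is a sublinear functional vanishing on [W]. *)
pose p y : R := inf [set `|y - v| | v in W].
have p_lb y : lbound [set `|y - v| | v in W] 0 by move=> _ [v _ <-].
have p_le y v : W v -> p y <= `|y - v|.
  by move=> Wv; apply: ge_inf; [exists 0; exact: p_lb|exists v].
have le_p y m : (forall v, W v -> m <= `|y - v|) -> m <= p y.
  move=> mv; apply: lb_le_inf; first by exists `|y - 0|, 0.
  by move=> _ [v Wv <-]; exact: mv.
have pn y : p y <= `|y| by apply: le_trans (p_le y 0 W0) _; rewrite subr0.
have sp : sublinear p.
  split=> [y z|c y].
    rewrite -lerBlDr; apply: (le_p) => u Wu.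
    rewrite lerBlDr -lerBlDl; apply: (le_p) => v Wv.
    have := p_le (y + z) (1 *: u + v) (WL _ _ _ Wu Wv).
    rewrite lerBlDl scale1r opprD addrACA => /le_trans; apply.
    exact: ler_normD.
  rewrite le_eqVlt => /predU1P[<-|c0].
    by rewrite scale0r mul0r (le_trans (pn _))// normr0.
  rewrite -ler_pdivrMl//; apply: (le_p) => v Wv; rewrite ler_pdivrMl//.
  have := p_le (c *: y) (c *: v + 0) (WL _ _ _ Wv W0).
  by rewrite addr0 -scalerBr normrZ gtr0_norm.
have [f [fp _ fpx]] := sublinear_dual x sp pn.
have px : p x = 0.
  rewrite -fpx; apply: fx => v Wv; apply/eqP; rewrite eq_le.
  have pW u : W u -> p u <= 0 by move=> /(p_le u); rewrite subrr normr0.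
  rewrite (le_trans (fp v) (pW _ Wv))//= -oppr_le0 -linearN.
  apply: le_trans (fp _) (pW _ _).
  by rewrite -(scaleN1r v) -[_ *: _]addr0; exact: WL.
have [|_ [v Wv <-] vx] := @inf_adherent R [set `|x - v| | v in W] e e0.
  by split; [exists `|x - 0|, 0|exists 0; exact: p_lb].
by exists v => //; rewrite -/(p x) px add0r in vx.
Qed.

Definition finite_span (x : nat -> X) : set X :=
  [set v | exists n (c : nat -> R), v = \sum_(i < n) c i *: x i].

Lemma finite_span0 (x : nat -> X) : finite_span x 0.
Proof. by exists 0%N, (fun=> 0); rewrite big_ord0. Qed.

Lemma finite_span_linear (x : nat -> X) (a : R) u v :
  finite_span x u -> finite_span x v -> finite_span x (a *: u + v).
Proof.
have pad n (c : nat -> R) N : (n <= N)%N ->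
    \sum_(i < n) c i *: x i = \sum_(i < N) (if (i < n)%N then c i else 0) *: x i.
  move=> nN; rewrite (big_ord_widen N (fun i => c i *: x i))// big_mkcond.
  by apply: eq_bigr => i _; case: ifP => // _; rewrite scale0r.
move=> [n [c ->]] [m [d ->]]; pose N := maxn n m.
rewrite (pad n c N) ?leq_maxl// (pad m d N) ?leq_maxr//.
rewrite scaler_sumr -big_split /=.
exists N, (fun i => a * (if (i < n)%N then c i else 0) + (if (i < m)%N then d i else 0)).
by apply: eq_bigr => i _; rewrite scalerDl scalerA.
Qed.

(** Rational coefficients suffice, and finite sequences of rationals are enumerated by
    [unpickle]. *)
Lemma finite_span_separable (x : nat -> X) : exists D : nat -> X,
  forall v e, finite_span x v -> 0 < e -> exists m, `|v - D m| < e.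
Proof.
pose comb (s : seq rat) := \sum_(i < size s) ratr s`_i *: x i : X.
exists (fun m => if unpickle m is Some s then comb s else 0).
suff dense n : forall (c : nat -> R) e, 0 < e -> exists s : seq rat,
    size s = n /\ `|\sum_(i < n) c i *: x i - comb s| < e.
  move=> _ e [n [c ->]] e0; have [s [_ se]] := dense n c e e0.
  by exists (pickle s); rewrite pickleK.
elim: n => [|n IH] c e e0.
  by exists [::]; split=> //; rewrite /comb !big_ord0 subrr normr0.
have [s [sn se]] := IH c (e / 2) (divr_gt0 e0 (ltr0Sn R 1)).
(* Changing the last coefficient by at most [t] moves the sum by at most [e / 2]; the [+ 1] keeps
   the denominator positive when [x n = 0]. *)
pose t := e / 2 / (`|x n| + 1).
have t0 : 0 < t by rewrite !divr_gt0// ltr_pwDr.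
have [|q] := @rat_in_itvoo R (c n - t) (c n); first by rewrite ltrBlDr ltrDl.
rewrite in_itv /= => /andP[q1 q2].
exists (rcons s q); split; first by rewrite size_rcons sn.
rewrite /comb size_rcons sn !big_ord_recr /= nth_rcons sn ltnn eqxx.
rewrite opprD addrACA -scalerBl.
have -> : \sum_(i < n) ratr (rcons s q)`_i *: x i = comb s.
  rewrite /comb sn; apply: eq_bigr => i _; by rewrite nth_rcons sn ltn_ord.
apply: le_lt_trans (ler_normD _ _) _; rewrite [ltRHS](splitr e).
apply: ltr_leD => //; rewrite normrZ.
have -> : e / 2 = t * (`|x n| + 1) by rewrite /t divfK// gt_eqF// ltr_pwDr.
apply: ler_pM => //; last by rewrite lerDl.
by rewrite ger0_norm; lra.
Qed.

(** [F m] norms the point [D m] of a sequence approximating the span. If [F m z = 0], the norm of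
    [D m] is at most that of [D m - z], so a [z] close to [D m] is itself small. *)
Lemma countable_separating_family (x : nat -> X) : exists F : nat -> dual X,
  forall z, (forall e, 0 < e -> exists2 v, finite_span x v & `|z - v| < e) ->
    (forall m, F m z = 0) -> z = 0.
Proof.
have [D Ddense] := finite_span_separable x.
have [F FP] := choice (fun m => norming_functional (D m)).
exists F => z zspan Fz; apply/eqP; rewrite -normr_le0; apply/ler_addgt0Pl => e e0.
have e4 : 0 < e / 4 by exact: divr_gt0.
have [v vx zv] := zspan _ e4; have [m vm] := Ddense _ _ vx e4.
have zm : `|z - D m| <= e / 2.
  rewrite -(subrKA v) (le_trans (ler_normD _ _))//; lra.
have [Fm Fle] := FP m.
have Dm : `|D m| <= e / 2.
  have := Fle (D m - z); rewrite linearB /= Fz subr0 Fm normr_id distrC => /le_trans; exact.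
rewrite addr0 -[z](subrK (D m)) (le_trans (ler_normD _ _))//; lra.
Qed.

End DualSpace.

(** * Limits along ultrafilters *)

Lemma ultra_fmap (T T' : Type) (u : T -> T') (U : set_system T) :
  UltraFilter U -> UltraFilter (u @ U).
Proof.
move=> UU; have PU := @ultra_proper _ _ UU.
constructor; first exact: fmap_proper_filter.
move=> G PG UG; apply/seteqP; split=> [A GA|]; last exact: UG.
have [//|UnA] := in_ultra_setVsetC (u @^-1` A) UU.
by have [x []] := filter_ex (filterI GA (UG (~` A) UnA)).
Qed.

Lemma ultra_bounded_cvg (R : realType) (T : Type) (U : set_system T)
    (u : T -> R) (M : R) :
  UltraFilter U -> (forall t, `|u t| <= M) -> exists l : R, u @ U --> l.
Proof.
move=> UU uM; have uU := ultra_fmap u UU.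
have := @segment_compact R (- M) M; rewrite compact_ultra => /(_ _ uU)[].
  have PU := @ultra_proper _ _ UU.
  apply: (@filterE _ U _ (u @^-1` `[- M, M])) => t.
  by rewrite /= in_itv /= -ler_norml.
by move=> l [_ ul]; exists l.
Qed.

(** * Weakly convergent subsequences in reflexive spaces *)

Section WeakSequentialCompactness.
Context {R : realType} {X : normedModType R}.
Hypothesis X_reflexive : reflexive_space X.

(** The limits of [f (x t)] along [U] depend linearly on [f] and are bounded by [M] times its norm;
    reflexivity represents this functional by a point. *)
Lemma ultra_weak_cvg (T : Type) (U : set_system T) (x : T -> X) (M : R) :
  UltraFilter U -> (forall t, `|x t| <= M) ->
  exists y, forall f : dual X, f (x t) @[t --> U] --> f y.
Proof.
move=> UU xM; have PU := @ultra_proper _ _ UU.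
have fxM (f : dual X) t : `|f (x t)| <= M * `|f|.
  rewrite (le_trans (dual_le_norm f (x t)))// mulrC ler_wpM2r//.
have [L fL] := choice (fun f : dual X => ultra_bounded_cvg UU (fxM f)).
have lL : linear (L : dual X -> R^o).
  move=> a f g; apply: (cvg_unique (@Rhausdorff R) (fL (a *: f + g))).
  apply: (@cvgD _ _ _ U _ (fun t => a *: (f (x t) : R^o)) (fun t => g (x t))).
    exact: cvgZl_tmp.
  exact: fL.
have [|Phi PhiL] := @bounded_linear_dual R (dual X) L M lL.
  move=> f; have /cvg_norm fLn := fL f.
  apply: (closed_cvg _ (@closed_le R (M * `|f|)) _ _ fLn).
  by apply: (@filterE _ U) => t; exact: fxM.
by have [y yP] := X_reflexive Phi; exists y => f; rewrite -yP PhiL.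
Qed.

(** [k] may repeat values; [i <= k i] is what lets limits along the original sequence pass to the
    selected one. *)
Theorem bounded_weak_subsequence (x : nat -> X) (M : R) :
  (forall n, `|x n| <= M) ->
  exists y (k : nat -> nat), (forall i, (i <= k i)%N) /\
    forall f : dual X, f (x (k i)) @[i --> \oo] --> f y.
Proof.
move=> xM; have [F Fsep] := countable_separating_family x.
have [U [UU ooU]] := @ultraFilterLemma nat \oo _.
have PU := @ultra_proper _ _ UU.
(* A functional that vanishes on every [x n] vanishes at a weak limit, so [annihilator_approx]
   applies to the span. *)
have span_limit (V : set_system nat) (k : nat -> nat) y : ProperFilter V ->
    (forall f : dual X, f (x (k i)) @[i --> V] --> f y) ->
    forall e, 0 < e -> exists2 v, finite_span x v & `|y - v| < e.
  move=> PV ky; apply: annihilator_approx.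
  - exact: finite_span0.
  - exact: finite_span_linear.
  - move=> f fspan.
    apply: (cvg_unique (@Rhausdorff R) (ky f)).
    have -> : (fun i => f (x (k i))) = (fun=> 0); last exact: cvg_cst.
    apply/funext => i; apply: fspan.
    exists (k i).+1, (fun j => (j == k i)%:R).
    rewrite big_ord_recr /= eqxx scale1r big1 ?add0r// => j _.
    by rewrite ltn_eqF ?scale0r/=.
have [y yU] := ultra_weak_cvg UU xM.
(* Finitely many conditions hold together on a member of [U], which meets every tail because [U]
   refines [\oo]. *)
have /choice[k kP] : forall i, exists n, (i <= n)%N /\
    forall m, (m <= i)%N -> `|F m y - F m (x n)| < i.+1%:R^-1.
  move=> i.
  have Fy : \forall n \near U, forall m : 'I_i.+1,
      `|F m y - F m (x n)| < i.+1%:R^-1.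
    apply: filter_forall => m.
    by have /cvgrPdist_lt := yU (F m); apply; rewrite invr_gt0.
  have [n [ni Fn]] := filter_ex (filterI (ooU _ (nbhs_infty_ge i)) Fy).
  by exists n; split=> // m; rewrite -ltnS => mi; exact: (Fn (Ordinal mi)).
have Fk m : F m (x (k i)) @[i --> \oo] --> F m y.
  apply/cvgrPdist_lt => e e0; near=> i.
  apply: (lt_trans ((kP i).2 m _)); first by near: i; exact: nbhs_infty_ge.
  by near: i; exact: (near_infty_natSinv_lt (PosNum e0)).
exists y, k; split=> [i|f]; first exact: (kP i).1.
apply/cvgrPdist_lt => e e0; apply: contrapT => Nfy.
(* If convergence fails for [f], the bad indices [B] meet every tail; an ultrafilter [V] containing
   [B] gives a second weak limit [z]. *)
pose B := [set i | ~ `|f y - f (x (k i))| < e].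
have PB : ProperFilter (within B \oo).
  split; last exact: within_filter.
  move=> oo0; apply: Nfy.
  by apply: (@filterS _ \oo _ (fun i => B i -> set0 i) _ _ oo0) => i /contrapT.
have [V [UV BV]] := ultraFilterLemma PB.
have PV := @ultra_proper _ _ UV.
have [z zV] := ultra_weak_cvg UV (fun i => xM (k i)).
have ooV : \oo `<=` V 
  by move=> A ooA; apply: BV; apply: (@filterS _ \oo _ A (fun i => B i -> A i)).
(* Both limits lie in the closed span, and by [Fk] no [F m] distinguishes them. *)
have zy : z - y = 0.
  apply: Fsep => [e1 e1_gt0|m].
    have [] := span_limit _ _ _ PV zV (e1 / 2); first by lra.
    move=> v vx zv; have [] := span_limit _ id _ PU yU (e1 / 2); first by lra.
    move=> w wx yw; exists ((-1) *: w + v); first exact: finite_span_linear.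
    rewrite scaleN1r (_ : _ - _ = (z - v) - (y - w)).
      by rewrite (le_lt_trans (ler_normB _ _))//; lra.
    by rewrite !opprD !opprK [w - v]addrC addrACA.
  apply/eqP; rewrite linearB /= subr_eq0; apply/eqP.
  apply: (cvg_unique (@Rhausdorff R) (zV (F m))).
  exact: cvg_trans (cvg_app _ ooV) (Fk m).
have /cvgrPdist_lt/(_ e e0) Vfz := zV f.
have VB : V B by apply: BV; exact: withinT.
have [i [/=]] := filter_ex (filterI Vfz VB).
by rewrite (subr0_eq zy).
Unshelve. all: by end_near. Qed.

End WeakSequentialCompactness.

(** * Sequences in the weak topology *)

(** Serves twice: for each functional defining the weak topology, and for the trace of that topology
    on [A]. *)
Lemma initial_topology_cvg (S : choiceType) (T : topologicalType) (f : S -> T)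
    (F : set_system S) (s : S) :
  Filter F -> f @ F --> f s -> F --> (s : initial_topology f).
Proof.
move=> FF fFs A [_ [[B oB <-] Bfs sBA]].
apply: (@filterS _ F _ (f @^-1` B)) => //; apply: fFs.
exact: open_nbhs_nbhs.
Qed.

Lemma weak_topology_cvg (R : realType) (X : normedModType R) (T : Type)
    (F : set_system T) (x : T -> X) (y : X) : Filter F ->
  (forall f : dual X, f (x t) @[t --> F] --> f y) ->
  (x t : weak_topology X) @[t --> F] --> (y : weak_topology X).
Proof.
move=> FF fxy; apply/cvg_sup => f.
exact: (@initial_topology_cvg X R^o f (x @ F) y _ (fxy f)).
Qed.

Lemma weakly_closed_seq_mem (R : realType) (X : normedModType R) (A : set X)
    (x : nat -> X) (y : X) : weakly_closed A -> (forall n, A (x n)) ->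
  (forall f : dual X, f (x n) @[n --> \oo] --> f y) -> A y.
Proof.
move=> cA Ax /weak_topology_cvg xy.
by apply: (@closed_cvg nat (weak_topology X) \oo _ x A cA _ y xy); exact: nearW.
Qed.

(** A neighbourhood of [y] on which [h] exceeds [h y - e] contains a tail of [u], so the infimum
    over that tail is at least [h y - e]. *)
Lemma lower_semicontinuous_limn_einf (R : realType) (T : topologicalType)
    (h : T -> R) (u : nat -> T) (y : T) :
  lower_semicontinuous (fun t => (h t)%:E) -> u @ \oo --> y ->
  ((h y)%:E <= limn_einf (fun n => (h (u n))%:E))%E.
Proof.
move=> lh uy; apply/lee_subgt0Pr => e e0.
have [|V Vy Vh] := lh y (h y - e); first by rewrite lte_fin ltrBlDr ltrDl.
have [N _ NV] := uy _ Vy.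
rewrite limn_einf_lim (cvg_lim _ (@cvg_einfs_sup R _))//.
apply: le_trans (ereal_sup_ubound (imageT _ N)).
apply: le_ereal_inf_tmp => _ [n /= Nn <-].
by rewrite -EFinB ltW//; apply: Vh; exact: (NV n).
Qed.

(** * Fatou's lemma with an integrable minorant *)

(** The integral of [s] may be [+oo], so positive and negative parts are integrated separately; the
    negative part of [s] is dominated by that of [g] and has a finite integral. *)
Lemma integral_ge_integrable d (T : measurableType d) (R : realType)
    (mu : {measure set T -> \bar R}) (s g : T -> R) :
  measurable_fun [set: T] s -> mu.-integrable [set: T] (EFin \o g) ->
  (forall t, g t <= s t) ->
  (\int[mu]_t (s t)%:E = \int[mu]_t (s t - g t)%:E + \int[mu]_t (g t)%:E)%E.
Proof.
move=> /measurable_EFinP ms ig gs; have mg := measurable_int _ ig.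
have mB : measurable_fun [set: T] (EFin \o (s \- g)).
  by apply/measurable_EFinP; apply: measurable_funB; exact/measurable_EFinP.
have mposneg (h : T -> R) : measurable_fun [set: T] (EFin \o h) ->
    measurable_fun [set: T] (EFin \o h)^\+%E /\
    measurable_fun [set: T] (EFin \o h)^\-%E.
  by move=> mh; split; [exact: measurable_funepos|exact: measurable_funeneg].
have [[msp msn] [mgp mgn]] := (mposneg _ ms, mposneg _ mg).
have B0 t : (0 <= (s t - g t)%:E)%E by rewrite lee_fin subr_ge0.
have sn_le t : ((EFin \o s)^\- t <= (EFin \o g)^\- t)%E.
  by apply: (@funeneg_le _ _ setT) => [? _|]; rewrite ?lee_fin ?inE.
(* Both sides are kept free of subtraction so that [ge0_integralD] applies even
   when the integral of [s] is infinite. *)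
have split_posneg :
    (\int[mu]_t (s t - g t)%:E + \int[mu]_t (EFin \o g)^\+ t +
     \int[mu]_t (EFin \o s)^\- t =
     \int[mu]_t (EFin \o s)^\+ t + \int[mu]_t (EFin \o g)^\- t)%E.
  rewrite -!ge0_integralD//; last 2 first.
    by move=> t _; rewrite adde_ge0.
    exact: emeasurable_funD.
  apply: eq_integral => t _; rewrite !funeposE !funenegE /=.
  rewrite -?EFinN -!EFin_max -!EFinD; congr EFin.
  by rewrite /Num.max; do ![case: ifP]; lra.
have sn_fin : (\int[mu]_t (EFin \o s)^\- t)%E \is a fin_num.
  rewrite ge0_fin_numE ?integral_ge0//.
  apply: le_lt_trans (integral_funeneg_lt_pinfty measurableT ig).
  exact: ge0_le_integral.
have gp_fin := integrable_pos_fin_num measurableT ig.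
have gn_fin := integrable_neg_fin_num measurableT ig.
rewrite (integralE mu setT (EFin \o s)) (integralE mu setT (EFin \o g)).
move: split_posneg sn_fin gp_fin gn_fin.
move: (\int[mu]_t (s t - g t)%:E)%E (\int[mu]_t (EFin \o g)^\+ t)%E
  (\int[mu]_t (EFin \o s)^\- t)%E (\int[mu]_t (EFin \o s)^\+ t)%E
  (\int[mu]_t (EFin \o g)^\- t)%E.
(* [b], [c] and [f] are finite, so [a] and [e] can only be infinite together; what remains is real
   arithmetic. *)
move=> [a||] [b||] [c||] [e||] [f||] //= [abcef] _ _ _.
by rewrite -!EFinB -EFinD; congr EFin; lra.
Qed.

(** Fatou's lemma is applied to the nonnegative functions [s n - g], and the finite integral of [g]
    is added back. *)
Lemma fatou_integrable_minorant d (T : measurableType d) (R : realType)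
    (mu : {measure set T -> \bar R}) (s : nat -> T -> R) (r g : T -> R) :
  (forall n, measurable_fun [set: T] (s n)) -> measurable_fun [set: T] r ->
  mu.-integrable [set: T] (EFin \o g) ->
  (forall n t, g t <= s n t) -> (forall t, g t <= r t) ->
  (forall t, (r t)%:E <= limn_einf (fun n => (s n t)%:E))%E ->
  (\int[mu]_t (r t)%:E <= limn_einf (fun n => \int[mu]_t (s n t)%:E))%E.
Proof.
move=> ms mr ig gs gr rs.
have mg : measurable_fun [set: T] g by apply/measurable_EFinP/measurable_int/ig.
rewrite (integral_ge_integrable mr ig gr).
under [in leRHS]eq_fun => n do rewrite (integral_ge_integrable (ms n) ig (gs n)) addeC.
rewrite limn_einf_shift; last exact: integral_fune_fin_num.
rewrite addeC leeD2l//.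
have mB (h : T -> R) : measurable_fun [set: T] h ->
    measurable_fun [set: T] (fun t => (h t - g t)%:E).
  by move=> mh; apply/measurable_EFinP; exact: measurable_funB.
have sB0 n t : [set: T] t -> (0 <= (s n t - g t)%:E)%E.
  by move=> _; rewrite lee_fin subr_ge0.
apply: le_trans (fatou mu measurableT (fun n => mB _ (ms n)) sB0).
apply: ge0_le_integral => //.
- by move=> t _; rewrite lee_fin subr_ge0.
- exact: mB.
- have -> : (fun t => limn_einf (fun n => (s n t - g t)%:E)) =
      -%E \o (fun t => limn_esup (fun n => - (s n t - g t)%:E))%E.
    by apply/funext => t /=; rewrite -[RHS]limn_einfN; congr limn_einf;
      apply/funext => n; rewrite /= opprK.
  apply: measurableT_comp; first exact: oppe_measurable.
  apply: measurable_fun_limn_esup => n; apply: measurableT_comp; last exact: mB.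
  exact: oppe_measurable.
- move=> t _.
  have -> : (fun n => (s n t - g t)%:E) = (fun n => (- g t)%:E + (s n t)%:E)%E.
    by apply/funext => n; rewrite -EFinD addrC.
  by rewrite limn_einf_shift// addrC EFinD leeD2l.
Qed.

(** * Coercivity and existence of a minimizer *)

(** An unbounded sequence has terms of norm above every [m]; along them coercivity would force [h]
    past [c]. *)
Lemma coercive_bounded (R : realType) (X : normedModType R) (A : set X)
    (h : A -> \bar R) (a : nat -> A) (c : R) :
  coercive h -> (forall n, (h (a n) <= c%:E)%E) ->
  exists M, forall n, `|set_val (a n)| <= M.
Proof.
move=> h_coercive hac; apply: contrapT => unbounded.
have /choice[k kP] : forall m : nat, exists n, m%:R < `|set_val (a n)|.
  move=> m; apply: contrapT => mP; apply: unbounded; exists m%:R => n.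
  by rewrite leNgt; apply/negP => mn; apply: mP; exists n.
have := h_coercive (a \o k).
have ak : (fun n => `|set_val ((a \o k) n)|) @ \oo --> +oo.
  by apply: ger_cvgy (@cvgr_idn R); apply: nearW => n; exact/ltW/kP.
move=> /(_ ak)/cvgeyPgt/(_ c) [N _ /(_ N (leqnn N))].
by rewrite ltNge hac.
Qed.

Theorem theorem3 (R : realType) (d : measure_display) (Omega : measurableType d)
    (Ps : set (probability Omega R))
    (X : completeNormedModType R) (X_reflexive : reflexive_space X)
    (A : set X) (A_neq0 : A !=set0) (A_closed : weakly_closed A)
    (S : A -> Omega -> R)
    (S_measurable : forall a : A, measurable_fun [set: Omega] (S a))
    (S_lsc : forall w : Omega,
      weakly_lower_semicontinuous (fun a : A => (S a w)%:E))
    (S_bounded : uniformly_bounded_below S Ps)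
    (P : probability Omega R) (P_Ps : Ps P)
    (S_coercive : coercive (expected_score S P)) :
  attains_minimum (expected_score S P).
Proof.
have [g [/(_ P P_Ps) ig gS]] := S_bounded.
set h := expected_score S P; set m := ereal_inf (range h).
have m_le a : (m <= h a)%E by apply: ereal_inf_lbound; exists a.
suff [a ha] : exists a, (h a <= m)%E by exists a => b; exact: le_trans (m_le b).
have [x0 Ax0] := A_neq0; pose a0 : A := SigSub (mem_set Ax0).
(* If the infimum is [+oo], any point is a minimizer. *)
have [moo|] := eqVneq m +oo%E; first by exists a0; rewrite moo leey.
rewrite -ltey => m_lty.
(* Together with [G_fin], this keeps [m] above [-oo]. *)
have G_le a : (\int[P]_w (g w)%:E <= h a)%E.
  rewrite /h /expected_score (integral_ge_integrable _ ig (gS a))//.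
  by rewrite leeDr// integral_ge0// => w _; rewrite lee_fin subr_ge0.
have G_fin := integral_fune_fin_num measurableT ig.
have m_fin : m \is a fin_num.
  rewrite fin_real// m_lty andbT (@lt_le_trans _ _ (\int[P]_w (g w)%:E)%E)//.
    by move: G_fin; rewrite fin_numElt => /andP[].
  by apply: le_ereal_inf_tmp => _ [a _ <-].
have /choice[a aP] : forall n : nat, exists a, (h a <= m + n.+1%:R^-1%:E)%E.
  move=> n; have n0 : 0 < n.+1%:R^-1 :> R by rewrite invr_gt0.
  have [_ [a _ <-] /ltW ha] := lb_ereal_inf_adherent n0 m_fin.
  by exists a.
have [M aM] : exists M, forall n, `|set_val (a n)| <= M.
  apply: (@coercive_bounded _ _ _ h a (fine m + 1)) => // n.
  apply: le_trans (aP n) _; rewrite EFinD fineK// leeD2l// lee_fin.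
  by rewrite invf_le1// ler1n.
have [y [k [k_ge ky]]] := bounded_weak_subsequence X_reflexive aM.
have Ay : A y.
  by apply: (weakly_closed_seq_mem A_closed _ ky) => n; exact: set_valP.
pose b : A := SigSub (mem_set Ay); exists b.
have ak_b : ((a \o k) : nat -> set_type (A : set (weak_topology X))) @ \oo -->
    (b : set_type (A : set (weak_topology X))).
  apply: initial_topology_cvg; exact: weak_topology_cvg ky.
(* Since [n <= k n], the error of the [n]-th selected term is at most [n.+1%:R^-1]. *)
have hk : (h (a (k n)) @[n --> \oo] --> m)%E.
  apply: (@squeeze_cvge _ _ _ _ (cst m) _ (fun n => (fine m + n.+1%:R^-1)%:E)).
  - apply: nearW => n; rewrite m_le /=; apply: le_trans (aP _) _.
    rewrite EFinD fineK// leeD2l// lee_fin lef_pV2 ?posrE//.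
    by rewrite ler_nat ltnS.
  - exact: cvg_cst.
  - rewrite -[m in _ --> m]fineK//; apply: cvg_EFin; first exact: nearW.
    rewrite -[X in _ --> X]addr0; apply: cvgD; first exact: cvg_cst.
    exact: cvg_harmonic.
rewrite -(cvg_limn_einf_sup hk).1.
apply: (fatou_integrable_minorant _ _ ig) => //.
move=> w; exact: lower_semicontinuous_limn_einf (S_lsc w) ak_b.
Qed.
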